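(* For every $X=\begin{bmatrix} A \\ B \end{bmatrix}\in\operatorname{skew}(p)\times\mathbb{R}^{(n-p)\times p}$, the absolute condition of $\varphi_E$ at $X$ is bounded by $$\|d(\varphi_E)_X\|_F\le 3.$$
   Context: Let $p\le n$ be positive integers; $\operatorname{skew}(p)$ is the space of real skew-symmetric $p\times p$ matrices, and elements of $\operatorname{skew}(p)\times\mathbb{R}^{(n-p)\times p}$ are written as stacked $n\times p$ matrices. With $\exp_m$ the matrix exponential, $$\varphi_E\left(\begin{bmatrix} A \\ B \end{bmatrix}\right)=\begin{bmatrix} \exp_m(A) \\ B \end{bmatrix}(I_p+B^TB)^{-1/2}\in\mathbb{R}^{n\times p}.$$ The absolute condition of a differentiable map $F$ at $X$ is the operator norm of its differential $dF_X$. For a linear map $L$ between matrix vector spaces, $\|L\|_F=\sup_{M\ne0}\|LM\|_F/\|M\|_F$ is the operator norm induced by the Frobenius norm. *)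

(* Defs.v *)
From HB Require Import structures.
From mathcomp Require Import all_boot all_order all_algebra.
From mathcomp Require Import all_classical all_reals all_analysis.

Set Implicit Arguments.
Unset Strict Implicit.
Unset Printing Implicit Defensive.
Import Order.TTheory GRing.Theory Num.Theory.
Import numFieldNormedType.Exports.
Local Open Scope classical_set_scope.
Local Open Scope ring_scope.

Section SkewMatrices.
Context (R : realType) (p : nat).

Definition skew_pred : {pred 'M[R]_p} := [pred A | A^T == - A].

Fact skew_submod_closed : submod_closed skew_pred.
Proof.
split=> [|a A B]; rewrite !inE ?trmx0 ?oppr0 // => /eqP skA /eqP skB.
by rewrite linearP /= skA skB scalerN opprD.
Qed.
HB.instance Definition _ :=
  GRing.isSubmodClosed.Build R 'M[R]_p skew_pred skew_submod_closed.

Record skew_matrix := SkewMatrix {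
  skew_val : 'M[R]_p;
  skew_valP : skew_val \in skew_pred
}.

HB.instance Definition _ := [isSub for skew_val].
HB.instance Definition _ := [Choice of skew_matrix by <:].
HB.instance Definition _ := [SubChoice_isSubLmodule of skew_matrix by <:].

(* The norm inherited from ['M[R]_p] is the entrywise maximum. It only serves to
   define the differential, which on finite-dimensional spaces does not depend
   on the choice of a norm; operator norms below use [frob] instead. *)
Definition skew_norm (A : skew_matrix) : R := `|skew_val A|.

Fact ler_skew_normD A B : skew_norm (A + B) <= skew_norm A + skew_norm B.
Proof. exact: ler_normD. Qed.

Fact skew_normZ (a : R) A : skew_norm (a *: A) = `|a| * skew_norm A.
Proof. exact: normrZ. Qed.

Fact skew_norm_eq0 A : skew_norm A = 0 -> A = 0.
Proof. by move=> /normr0_eq0 A0; apply: val_inj. Qed.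

HB.instance Definition _ :=
  Lmodule_isNormed.Build R skew_matrix ler_skew_normD skew_normZ skew_norm_eq0.

End SkewMatrices.

Definition frob (R : realType) (m n : nat) (M : 'M[R]_(m, n)) : R :=
  Num.sqrt (\sum_i \sum_j M i j ^+ 2).

(* The supremum is taken in [0, +oo]: adjoining 0 to the set of quotients only
   matters when V = 0 (empty set of quotients). *)
Definition opnorm (R : realType) (V W : lmodType R) (nV : V -> R) (nW : W -> R)
    (L : {linear V -> W}) : \bar R :=
  ereal_sup (0%:E |` [set (nW (L M) / nV M)%:E | M in [set M | M != 0]]).

Definition expmx (R : realType) (p : nat) (A : 'M[R]_p) : 'M[R]_p :=
  limn (series (fun k => (k`!%:R)^-1 *: A ^+ k)).

(* The principal square root: for A symmetric positive semidefinite there is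
   exactly one such S. *)
Definition sqrtmx (R : realType) (p : nat) (A : 'M[R]_p) : 'M[R]_p :=
  get [set S | [/\ S^T = S, forall x : 'cV[R]_p, 0 <= (x^T *m S *m x) 0 0
                 & S *m S = A]].

Section PhiE.
Context (R : realType) (p m : nat).

Definition stack (X : skew_matrix R p * 'M[R]_(m, p)) : 'M[R]_(p + m, p) :=
  col_mx (skew_val X.1) X.2.

Definition phiE (X : skew_matrix R p * 'M[R]_(m, p)) : 'M[R]_(p + m, p) :=
  col_mx (expmx (skew_val X.1)) X.2
    *m invmx (sqrtmx (1%:M + X.2^T *m X.2)).

Definition opnormF
    (L : {linear (skew_matrix R p * 'M[R]_(m, p))%type -> 'M[R]_(p + m, p)}) :
    \bar R :=
  opnorm (fun M => frob (stack M)) (@frob R (p + m) p) L.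

End PhiE.

(* Main.v *)
(* Write U = phiE (A, B) = Z T with Z = [exp A; B], S = (1 + B^T B)^(1/2) and
   T = S^-1.  For (H, K) in the tangent space, differentiating U S = Z gives
   dU = (dZ - U Y) T, where Y = dS solves the Lyapunov equation
   S Y + Y S = K^T B + B^T K.  Since T and U = Z T are contractions,
   |dU| <= |dZ| + |Y T|.
   - |dZ|^2 = |dexp_A H|^2 + |K|^2 <= |H|^2 + |K|^2, because exp is 1-Lipschitz
     on skew matrices: this is inherited from (1 + A/n)^n, as
     |(1 + A/n) N|^2 = |N|^2 + |A N|^2 / n^2 for skew A.
   - Multiplying the Lyapunov equation by T on both sides gives
     T Y + Y T = G + G^T with G = (T K^T) (B T), so |G| <= |K|.  As T is
     positive, <T Y, Y T> >= 0, hence 2 |Y T|^2 <= |T Y + Y T|^2 <= 4 |K|^2.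
   Differentiability itself comes from explicit quadratic remainder bounds. *)
From HB Require Import structures.
Require Import Defs.
From mathcomp Require Import all_boot all_order all_algebra.
From mathcomp Require Import all_classical all_reals all_analysis.
From mathcomp Require Import ring lra.
Import Order.TTheory GRing.Theory Num.Theory.
Import numFieldNormedType.Exports.
Local Open Scope classical_set_scope.
Local Open Scope ring_scope.

Set Implicit Arguments.
Unset Strict Implicit.
Unset Printing Implicit Defensive.

(** * The Frobenius inner product and norm *)

Section Frobenius.
Context {R : realType}.
Implicit Types (a b c : R) (m n p q : nat).

Definition ip m n (M N : 'M[R]_(m, n)) : R := \tr (M *m N^T).

Lemma ipE m n (M N : 'M[R]_(m, n)) : ip M N = \sum_i \sum_j M i j * N i j.
Proof.
by apply: eq_bigr => i _; rewrite mxE; apply: eq_bigr => j _; rewrite mxE.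
Qed.

Lemma ipC m n (M N : 'M[R]_(m, n)) : ip M N = ip N M.
Proof. by rewrite /ip -mxtrace_tr trmx_mul trmxK. Qed.

Lemma ipDl m n (M N P : 'M[R]_(m, n)) : ip (M + N) P = ip M P + ip N P.
Proof. by rewrite /ip mulmxDl linearD. Qed.

Lemma ipZl m n a (M P : 'M[R]_(m, n)) : ip (a *: M) P = a * ip M P.
Proof. by rewrite /ip -scalemxAl linearZ. Qed.

Lemma ipNl m n (M P : 'M[R]_(m, n)) : ip (- M) P = - ip M P.
Proof. by rewrite -scaleN1r ipZl mulN1r. Qed.

Lemma ip0l m n (M : 'M[R]_(m, n)) : ip 0 M = 0.
Proof. by rewrite /ip mul0mx linear0. Qed.

Lemma ip0r m n (M : 'M[R]_(m, n)) : ip M 0 = 0.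
Proof. by rewrite ipC ip0l. Qed.

Lemma ipBl m n (M N P : 'M[R]_(m, n)) : ip (M - N) P = ip M P - ip N P.
Proof. by rewrite ipDl ipNl. Qed.

Lemma ipDr m n (M N P : 'M[R]_(m, n)) : ip P (M + N) = ip P M + ip P N.
Proof. by rewrite ipC ipDl !(ipC P). Qed.

Lemma ipZr m n a (M P : 'M[R]_(m, n)) : ip P (a *: M) = a * ip P M.
Proof. by rewrite ipC ipZl ipC. Qed.

Lemma ipNr m n (M P : 'M[R]_(m, n)) : ip P (- M) = - ip P M.
Proof. by rewrite ipC ipNl ipC. Qed.

Lemma ipBr m n (M N P : 'M[R]_(m, n)) : ip P (M - N) = ip P M - ip P N.
Proof. by rewrite ipDr ipNr. Qed.

Lemma ipMl m n p (A : 'M[R]_(m, n)) (M : 'M[R]_(n, p)) N :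
  ip (A *m M) N = ip M (A^T *m N).
Proof. by rewrite /ip trmx_mul trmxK -mulmxA mxtrace_mulC -mulmxA. Qed.

Lemma ipMr m n p (A : 'M[R]_(n, p)) (M : 'M[R]_(m, n)) N :
  ip (M *m A) N = ip M (N *m A^T).
Proof. by rewrite /ip trmx_mul trmxK -mulmxA. Qed.

Lemma ip_trmx m n (M N : 'M[R]_(m, n)) : ip M^T N^T = ip M N.
Proof. by rewrite /ip trmxK mxtrace_mulC -/(ip N M) ipC. Qed.

Lemma ip_ge0 m n (M : 'M[R]_(m, n)) : 0 <= ip M M.
Proof.
by rewrite ipE; do 2!(apply: sumr_ge0 => ? _); rewrite -expr2 sqr_ge0.
Qed.

Lemma frobE m n (M : 'M[R]_(m, n)) : frob M = Num.sqrt (ip M M).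
Proof.
by rewrite /frob ipE.
Qed.

Lemma sqr_frob m n (M : 'M[R]_(m, n)) : frob M ^+ 2 = ip M M.
Proof. by rewrite frobE sqr_sqrtr ?ip_ge0. Qed.

Lemma frob_ge0 m n (M : 'M[R]_(m, n)) : 0 <= frob M.
Proof. exact: sqrtr_ge0. Qed.
Hint Resolve frob_ge0 : core.

(** Squaring removes the root, so that norm bounds can be proved by expanding inner products. *)
Lemma frob_le m n p q (M : 'M[R]_(m, n)) (N : 'M[R]_(p, q)) c :
  0 <= c -> (frob M <= c * frob N) = (ip M M <= c ^+ 2 * ip N N).
Proof.
move=> c0; rewrite -!sqr_frob -exprMn ler_pXn2r ?nnegrE //.
by rewrite mulr_ge0.
Qed.

Lemma frobZ m n a (M : 'M[R]_(m, n)) : frob (a *: M) = `|a| * frob M.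
Proof.
by rewrite !frobE ipZl ipZr mulrA -expr2 sqrtrM ?sqr_ge0// sqrtr_sqr.
Qed.

Lemma frobN m n (M : 'M[R]_(m, n)) : frob (- M) = frob M.
Proof. by rewrite !frobE ipNl ipNr opprK. Qed.

Lemma frob0 m n : frob (0 : 'M[R]_(m, n)) = 0.
Proof. by rewrite frobE ip0l sqrtr0. Qed.

Lemma frob_trmx m n (M : 'M[R]_(m, n)) : frob M^T = frob M.
Proof. by rewrite !frobE ip_trmx. Qed.

Lemma entry_le_frob m n (M : 'M[R]_(m, n)) i j : `|M i j| <= frob M.
Proof.
rewrite -ler_sqr ?nnegrE// sqr_frob ipE real_normK ?num_real//.
rewrite (bigD1 i)//= (bigD1 j)//= expr2 -addrA lerDl addr_ge0//.
  by apply: sumr_ge0 => ? _; rewrite -expr2 sqr_ge0.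
by do 2!(apply: sumr_ge0 => ? _); rewrite -expr2 sqr_ge0.
Qed.

Lemma frob_eq0 m n (M : 'M[R]_(m, n)) : frob M = 0 -> M = 0.
Proof.
move=> M0; apply/matrixP => i j; rewrite mxE; apply/normr0_eq0/eqP.
by rewrite eq_le normr_ge0 -M0 entry_le_frob.
Qed.

Lemma frob_gt0 m n (M : 'M[R]_(m, n)) : (0 < frob M) = (M != 0).
Proof.
rewrite lt_def frob_ge0 andbT; congr (~~ _).
by apply/eqP/eqP => [/frob_eq0|->]//; rewrite frob0.
Qed.

Lemma ip_le_frob m n (M N : 'M[R]_(m, n)) : ip M N <= frob M * frob N.
Proof.
have [->|N0] := eqVneq N 0; first by rewrite frob0 mulr0 ip0r.
have [->|M0] := eqVneq M 0; first by rewrite frob0 mul0r ip0l.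
(* Expanding this square gives [2 |M| |N| <M, N> <= 2 |M|^2 |N|^2]; both norms are positive here and
   cancel. *)
have := ip_ge0 (frob N *: M - frob M *: N).
rewrite ipBl !ipBr !ipZl !ipZr -!sqr_frob (ipC N M).
move: N0 M0; rewrite -!frob_gt0; move: (frob M) (frob N) (ip M N) => x y z.
by move=> y0 x0 h; rewrite -(ler_pM2l (mulr_gt0 x0 y0)); lra.
Qed.

Lemma frobD m n (M N : 'M[R]_(m, n)) : frob (M + N) <= frob M + frob N.
Proof.
rewrite -ler_sqr ?nnegrE ?addr_ge0// sqr_frob ipDl !ipDr (ipC N M).
rewrite -!sqr_frob; have := ip_le_frob M N; lra.
Qed.

Lemma frobB m n (M N : 'M[R]_(m, n)) : frob (M - N) <= frob M + frob N.
Proof. by rewrite -(frobN N) frobD. Qed.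

Lemma frob_subC m n (M N : 'M[R]_(m, n)) : frob (M - N) = frob (N - M).
Proof. by rewrite -frobN opprB. Qed.

Lemma ler_frob_dist m n (M N : 'M[R]_(m, n)) :
  `|frob M - frob N| <= frob (M - N).
Proof.
rewrite ler_norml lerNl opprB !lerBlDr {1}frob_subC.
by rewrite -{1}(subrK M N) frobD -{1}(subrK N M) frobD.
Qed.

Lemma frob_sum m n (I : Type) (r : seq I) (P : pred I) (F : I -> 'M[R]_(m, n)) :
  frob (\sum_(i <- r | P i) F i) <= \sum_(i <- r | P i) frob (F i).
Proof.
elim/big_ind2 : _ => [|M a N b Ma Nb|//]; first by rewrite frob0.
exact: le_trans (frobD _ _) (lerD Ma Nb).
Qed.

(** Each entry of the product pairs a row of [M] with a column of [N]; Cauchy-Schwarz bounds its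
    square and the double sum factors. *)
Lemma frobM m n p (M : 'M[R]_(m, n)) (N : 'M[R]_(n, p)) :
  frob (M *m N) <= frob M * frob N.
Proof.
rewrite -ler_sqr ?nnegrE ?mulr_ge0// exprMn !sqr_frob.
rewrite -(ip_trmx N) !ipE mulr_suml; apply: ler_sum => i _.
rewrite mulr_sumr; apply: ler_sum => j _; rewrite -expr2.
have ipij : ip (row i M) (col j N)^T = (M *m N) i j.
  by rewrite ipE big_ord1 mxE; apply: eq_bigr => k _; rewrite !mxE.
have := ip_le_frob (row i M) (col j N)^T.
(* The negated row gives the lower bound on the entry, hence the bound on its absolute value. *)
have := ip_le_frob (- row i M) (col j N)^T; rewrite ipNl frobN ipij => l1 l2.
have -> : \sum_k M i k * M i k = frob (row i M) ^+ 2.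
  by rewrite sqr_frob ipE big_ord1; apply: eq_bigr => k _; rewrite !mxE.
have -> : \sum_k N^T j k * N^T j k = frob (col j N)^T ^+ 2.
  by rewrite sqr_frob ipE big_ord1; apply: eq_bigr => k _; rewrite !mxE.
rewrite -exprMn -(real_normK (num_real ((M *m N) i j))).
rewrite ler_sqr ?nnegrE ?mulr_ge0//.
by rewrite ler_norml l2 lerNl l1.
Qed.

Lemma sqr_frob_col_mx m n p (M : 'M[R]_(m, p)) (N : 'M[R]_(n, p)) :
  frob (col_mx M N) ^+ 2 = frob M ^+ 2 + frob N ^+ 2.
Proof.
rewrite !sqr_frob !ipE big_split_ord /=; congr (_ + _); apply: eq_bigr => i _;
  by apply: eq_bigr => j _; rewrite ?col_mxEu ?col_mxEd.
Qed.

Lemma normr_mxE m n (M : 'M[R]_(m, n)) :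
  `|M| = \big[Num.max/0]_ij `|M ij.1 ij.2|.
Proof. exact: mx_normrE. Qed.

Lemma normr_le_frob m n (M : 'M[R]_(m, n)) : `|M| <= frob M.
Proof.
rewrite normr_mxE; apply/bigmax_leP; split => // -[i j] _ /=.
exact: entry_le_frob.
Qed.

Lemma entry_le_normr m n (M : 'M[R]_(m, n)) i j : `|M i j| <= `|M|.
Proof.
rewrite normr_mxE.
exact: (le_bigmax _ (fun ij : 'I_m * 'I_n => `|M ij.1 ij.2|) (i, j)).
Qed.

(** The topology on matrices comes from the maximum norm. Together with [normr_le_frob], this crude
    comparison lets Frobenius distances express convergence. *)
Lemma frob_le_normr m n (M : 'M[R]_(m, n)) : frob M <= (m * n)%:R * `|M|.
Proof.
apply: (@le_trans _ _ (\sum_i \sum_j `|M i j|)); last first.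
  apply: (@le_trans _ _ (\sum_(i < m) \sum_(j < n) `|M|)).
    by do 2!(apply: ler_sum => ? _); exact: entry_le_normr.
  by rewrite !sumr_const !card_ord -mulrnA mulr_natl mulnC.
rewrite {1}(matrix_sum_delta M); apply: le_trans (frob_sum _ _ _) _.
apply: ler_sum => i _; apply: le_trans (frob_sum _ _ _) _.
apply: ler_sum => j _; rewrite frobZ ler_piMr//.
rewrite -(@ler_sqr R) ?nnegrE// sqr_frob ipE expr1n.
rewrite (bigD1 i)//= (bigD1 j)//= !mxE !eqxx/= mulr1 !big1 ?addr0//.
  by move=> k ki; apply: big1 => l _; rewrite mxE (negbTE ki) mul0r.
by move=> l lj; rewrite mxE (negbTE lj) andbF mul0r.
Qed.

Lemma cvg_frobP m n (u : nat -> 'M[R]_(m, n)) (l : 'M[R]_(m, n)) :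
  u @ \oo --> l <-> (fun k => frob (u k - l)) @ \oo --> (0 : R).
Proof.
split=> ul.
  apply: (@squeeze_cvgr _ _ _ _ (cst 0) (fun k => (m * n)%:R * `|u k - l|)).
  - by near=> k; rewrite frob_ge0 frob_le_normr.
  - exact: cvg_cst.
  - rewrite -[0 in X in _ --> X](mulr0 (m * n)%:R); apply: cvgMl_tmp.
    by apply/norm_cvg0P/subr_cvg0.
apply/subr_cvg0/norm_cvg0P.
apply: (@squeeze_cvgr _ _ _ _ (cst 0) (fun k => frob (u k - l))) => //.
  by near=> k; rewrite normr_ge0 normr_le_frob.
exact: cvg_cst.
Unshelve. all: by end_near. Qed.

Lemma frob_cvg m n (u : nat -> 'M[R]_(m, n)) (l : 'M[R]_(m, n)) :
  u @ \oo --> l -> (fun k => frob (u k)) @ \oo --> frob l.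
Proof.
move=> /cvg_frobP ul; apply/subr_cvg0/norm_cvg0P.
apply: (@squeeze_cvgr _ _ _ _ (cst 0) (fun k => frob (u k - l))) => //; last first.
  exact: cvg_cst.
by near=> k; rewrite normr_ge0 ler_frob_dist.
Unshelve. all: by end_near. Qed.

Lemma cvg_mx_unique m n (u : nat -> 'M[R]_(m, n)) (l k : 'M[R]_(m, n)) :
  u @ \oo --> l -> u @ \oo --> k -> l = k.
Proof. exact: (cvg_unique (@norm_hausdorff R _)). Qed.

Lemma cvg_mulmx m n p (u : nat -> 'M[R]_(m, n)) (v : nat -> 'M[R]_(n, p))
    (l : 'M[R]_(m, n)) (k : 'M[R]_(n, p)) :
  u @ \oo --> l -> v @ \oo --> k -> (fun i => u i *m v i) @ \oo --> l *m k.
Proof.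
move=> /cvg_frobP ul /cvg_frobP vk; apply/cvg_frobP.
pose a i := frob (u i - l); pose b i := frob (v i - k).
apply: (@squeeze_cvgr _ _ _ _ (cst 0)
  (fun i => a i * b i + a i * frob k + frob l * b i)); last 2 first.
- exact: cvg_cst.
- have -> : (0 : R) = 0 * 0 + 0 * frob k + frob l * 0.
    by rewrite mulr0 mul0r mulr0 !addr0.
  by apply: cvgD; [apply: cvgD|]; apply: cvgM => //; exact: cvg_cst.
near=> i; rewrite frob_ge0/=.
have -> : u i *m v i - l *m k =
    (u i - l) *m (v i - k) + (u i - l) *m k + l *m (v i - k).
  by rewrite -mulmxDr subrK !mulmxBl !mulmxBr addrA subrK.
apply: le_trans (frobD _ _) (lerD (le_trans (frobD _ _) (lerD _ _)) _);
  exact: frobM.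
Unshelve. all: by end_near. Qed.

Lemma cvg_trmx m n (u : nat -> 'M[R]_(m, n)) (l : 'M[R]_(m, n)) :
  u @ \oo --> l -> (fun k => (u k)^T) @ \oo --> l^T.
Proof.
move=> /cvg_frobP ul; apply/cvg_frobP.
rewrite (_ : (fun k => _) = (fun k => frob (u k - l)))//.
by apply/funext => k; rewrite -linearB frob_trmx.
Qed.

(** Joins completeness with the norm on matrices, so that [normed_cvg] applies below. *)
HB.instance Definition _ m n := Complete.on 'M[R]_(m, n).

Lemma frob_cvg_series m n (u : nat -> 'M[R]_(m, n)) (v : nat -> R) :
  (forall k, frob (u k) <= v k) -> cvgn (series v) -> cvgn (series u).
Proof.
move=> uv cv; apply: normed_cvg.
apply: series_le_cvg cv => k //=; last exact: le_trans (normr_le_frob _) (uv k).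
exact: le_trans (uv k).
Qed.

End Frobenius.

#[local] Hint Extern 0 (is_true (0 <= frob _)) =>
  solve [apply: frob_ge0] : core.

(** * Square roots of positive matrices *)

Section PositiveSquareRoot.
Context {R : realType}.
Implicit Types (m n p q : nat).

(** This is [S >= 1] in the Loewner order. Letting [N] be a matrix of any width, rather than a
    vector, makes the bound directly usable with Frobenius norms. *)
Definition ge1mx p (S : 'M[R]_p) :=
  S^T = S /\ forall q (N : 'M[R]_(p, q)), ip N N <= ip N (S *m N).

Lemma frob_mul_sym p (Z : 'M[R]_p) (r : R) : 0 < r -> Z^T = Z ->
  (forall q (N : 'M[R]_(p, q)), 0 <= ip N (Z *m N) <= r * ip N N) ->
  forall q (N : 'M[R]_(p, q)), frob (Z *m N) <= r * frob N.
Proof.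
move=> r0 Zs Zr q N; rewrite frob_le ?(ltW r0)//.
(* polarization: 4 r <G, Z N> = <rN + G, Z(rN + G)> - <rN - G, Z(rN - G)> *)
pose G := Z *m N.
have e : ip N (Z *m G) = ip G G by rewrite ipC ipMl Zs ipC.
have /andP[_] := Zr _ (r *: N + G); have /andP[+ _] := Zr _ (r *: N - G).
(* Adding [r |rN - G|^2 >= 0] to the bound [r |rN + G|^2] yields, by the parallelogram law,
   [4 r |G|^2 <= 2 r (r^2 |N|^2 + |G|^2)]. *)
have := mulr_ge0 (ltW r0) (ip_ge0 (r *: N - G)).
rewrite !mulmxDr mulmxN -!scalemxAr -/G !(ipDl, ipDr, ipNl, ipNr, ipZl, ipZr).
rewrite e (ipC G N); move: (ip N N) (ip N G) (ip G G) (ip G (Z *m G)) => n x g y.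
move=> h1 h2 h3; have r20 : 0 < 2 * r by rewrite mulr_gt0.
by rewrite -(ler_pM2l r20); lra.
Qed.

Lemma ge1mx_sqrt_exists p (P : 'M[R]_p) :
  ge1mx P -> exists S, ge1mx S /\ S *m S = P.
Proof.
move=> [Ps P1].
(* The fixed point Y of Y |-> (Z + Y^2)/2 satisfies (1 - Y)^2 = 1 - Z = P/c. *)
pose c := 2 + frob P; pose s := Num.sqrt c; pose r := 1 - s^-1.
have c2 : 2 <= c by rewrite /c lerDl frob_ge0.
have c0 : 0 < c by lra.
have s1 : 1 < s by rewrite -[1]sqrtr1 ltr_sqrt//; lra.
have s0 : 0 < s by lra.
have ss : s * s = c by rewrite -expr2 sqr_sqrtr// ltW.
have r0 : 0 < r by rewrite subr_gt0 invf_lt1.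
have r1 : r < 1 by rewrite ltrBlDr ltrDl invr_gt0.
(* [r] is the smaller root of this equation, the scalar version of the fixed-point equation; hence
   the bound [r] is preserved by the iteration. *)
have er : 2 * r = (1 - c^-1) + r * r by rewrite -ss /r; field; rewrite gt_eqF.
have rho0 : 0 < 1 - c^-1 by rewrite subr_gt0 invf_lt1//; lra.
pose Z : 'M[R]_p := 1%:M - c^-1 *: P.
have Zs : Z^T = Z by rewrite linearB linearZ /= trmx1 Ps.
(* Since [1 <= P <= c], the upper bound coming from [frob P <= c], one has [0 <= Z <= 1 - 1/c]. *)
have Zb q (N : 'M[R]_(p, q)) : frob (Z *m N) <= (1 - c^-1) * frob N.
  apply: frob_mul_sym => // {}q {}N.
  rewrite mulmxBl mul1mx -scalemxAl ipBr ipZr.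
  have h1 : ip N (P *m N) <= c * ip N N.
    apply: le_trans (ip_le_frob _ _) _; rewrite -sqr_frob expr2 mulrCA.
    rewrite ler_wpM2l//; apply: le_trans (frobM _ _) _.
    by rewrite ler_wpM2r// lerDr.
  have h2 := P1 _ N; have ci : 0 < c^-1 by rewrite invr_gt0.
  apply/andP; split; last by rewrite mulrBl mul1r lerD2l lerN2 ler_pM2l.
  by rewrite subr_ge0 mulrC ler_pdivrMr// mulrC.
pose f (Y : 'M[R]_p) := 2^-1 *: (Z + Y *m Y).
pose Y k := iter k f 0.
have Ys k : (Y k)^T = Y k.
  elim: k => [|k IH]; first by rewrite trmx0.
  by rewrite /= linearZ linearD /= trmx_mul IH Zs.
have Yb k q (N : 'M[R]_(p, q)) : frob (Y k *m N) <= r * frob N.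
  elim: k q N => [|k IH] q N; first by rewrite mul0mx frob0 mulr_ge0// ltW.
  rewrite /= -scalemxAl frobZ ger0_norm ?invr_ge0// ler_pdivrMl//.
  rewrite mulrA er mulmxDl [leRHS]mulrDl; apply: le_trans (frobD _ _) _.
  rewrite lerD// -mulmxA -mulrA; apply: le_trans (IH _ _) _.
  by rewrite ler_wpM2l ?(ltW r0).
have Yd k : frob (Y k.+1 - Y k) <= geometric (frob (Y 1%N)) r k.
  rewrite /geometric /=; elim: k => [|k IH]; first by rewrite subr0 expr0 mulr1.
  rewrite exprSr mulrA; apply: le_trans (_ : _ <= frob (Y k.+1 - Y k) * r) _;
    last by rewrite ler_wpM2r// ltW.
  (* This splitting of a difference of squares holds without commutation. The factor [Y k] on the
     right is then brought to the left by transposing. *)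
  have -> : Y k.+2 - Y k.+1 =
      2^-1 *: (Y k.+1 *m (Y k.+1 - Y k) + (Y k.+1 - Y k) *m Y k).
    by rewrite mulmxBr mulmxBl addrA subrK /= -scalerBr opprD addrACA subrr add0r.
  rewrite frobZ ger0_norm ?invr_ge0// ler_pdivrMl//.
  apply: le_trans (frobD _ _) _; rewrite (mulrC _ r).
  rewrite mulr_natl mulr2n lerD// -frob_trmx trmx_mul Ys.
  have -> : (Y k.+1 - Y k)^T = Y k.+1 - Y k.
    by rewrite linearB; congr (_ - _); exact: Ys.
  exact: Yb.
have : cvgn Y.
  have /(frob_cvg_series Yd) : cvgn (series (geometric (frob (Y 1%N)) r)).
    by apply: is_cvg_geometric_series; rewrite ger0_norm// ltW.
  by rewrite (_ : series _ = Y)//; apply/funext => k;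
    rewrite /series /= telescope_sumr// subr0.
set L := limn Y => YL.
have Ls : L^T = L.
  apply: cvg_mx_unique (cvg_trmx YL) _.
  by rewrite (_ : (fun k => _) = Y)//; apply/funext => k; rewrite Ys.
have Lb q (N : 'M[R]_(p, q)) : frob (L *m N) <= r * frob N.
  apply: (cvgr_to_le (frob_cvg (cvg_mulmx YL (cvg_cst N)))).
  by near=> k; exact: Yb.
have LE : 2 *: L = Z + L *m L.
  have : f (Y k) @[k --> \oo] --> 2^-1 *: (Z + L *m L).
    by apply: cvgZl_tmp; apply: cvgD (cvg_cst _) (cvg_mulmx YL YL).
  move/cvg_mx_unique => /(_ L) eL; rewrite -[in LHS]eL; last first.
    by move: YL; rewrite -cvg_shiftS.
  by rewrite scalerA divff// scale1r.
(* The square is [c (1 - 2L + L^2) = c (1 - Z) = P], and the lower bound 1 is [s (1 - r)]. *)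
exists (s *: (1%:M - L)); split; last first.
  rewrite -scalemxAl -scalemxAr scalerA ss mulmxBl mul1mx mulmxBr mulmx1.
  have -> : 1%:M - L - (L - L *m L) = 1%:M - Z.
    have -> : Z = L + L - L *m L by rewrite -mulr2n -scaler_nat LE addrK.
    by rewrite !opprD !opprK !addrA.
  by rewrite /Z opprB addrC subrK scalerA divff ?scale1r// gt_eqF.
split; first by rewrite linearZ linearB /= trmx1 Ls.
move=> q N; rewrite -scalemxAl ipZr mulmxBl mul1mx ipBr.
have h : ip N (L *m N) <= r * ip N N.
  apply: le_trans (ip_le_frob _ _) _.
  by rewrite -sqr_frob expr2 mulrCA ler_wpM2l.
have e : ip N N = s * (ip N N - r * ip N N) by rewrite /r; field; rewrite gt_eqF.
by rewrite {1}e ler_pM2l// lerD2l lerN2.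
Unshelve. all: by end_near. Qed.

End PositiveSquareRoot.

(** * Uniqueness of the positive square root and the Lyapunov equation *)

Section PolarFactor.
Context {R : realType}.
Implicit Types (m n p q : nat).

Lemma ip_col m n (M N : 'M[R]_(m, n)) :
  ip M N = \sum_j ((col j M)^T *m col j N) 0 0.
Proof.
rewrite ipE exchange_big; apply: eq_bigr => j _.
by rewrite mxE; apply: eq_bigr => i _; rewrite !mxE.
Qed.

(** Summing over columns passes from the vector condition in [sqrtmx] to matrices. *)
Lemma ip_psd_ge0 p q (S : 'M[R]_p) (N : 'M[R]_(p, q)) :
  (forall x : 'cV[R]_p, 0 <= (x^T *m S *m x) 0 0) -> 0 <= ip N (S *m N).
Proof.
move=> S0; rewrite ip_col; apply: sumr_ge0 => j _.
by rewrite [col j (S *m N)]colE -mulmxA -colE mulmxA.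
Qed.

Lemma ge1mx_psd p (S : 'M[R]_p) (x : 'cV[R]_p) :
  ge1mx S -> 0 <= (x^T *m S *m x) 0 0.
Proof.
move=> [_ S1]; apply: le_trans (ip_ge0 x) (le_trans (S1 _ x) _).
by rewrite ip_col big_ord1 !col_id mulmxA.
Qed.

Lemma ge1mx_mulr p q (S : 'M[R]_p) (N : 'M[R]_(q, p)) :
  ge1mx S -> ip N N <= ip N (N *m S).
Proof.
move=> [Ss S1]; have := S1 _ N^T.
by rewrite -{1}Ss -trmx_mul !ip_trmx.
Qed.

(** Pairing with [X] gives at least [2 |X|^2], and Cauchy-Schwarz concludes. Two coefficients are
    allowed so that the roots of two different matrices can be compared. *)
Lemma frob_lyapunov p (S S' X : 'M[R]_p) : ge1mx S -> ge1mx S' ->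
  2 * frob X <= frob (S *m X + X *m S').
Proof.
move=> [_ S1] S1'; have := ip_le_frob X (S *m X + X *m S').
rewrite ipDr => h; have h1 := S1 _ X; have h2 := ge1mx_mulr X S1'.
have [->|] := eqVneq X 0; first by rewrite frob0 mulr0.
rewrite -frob_gt0 => X0; rewrite -(ler_pM2l X0).
by apply: le_trans h; rewrite mulrCA -expr2 sqr_frob; lra.
Qed.

Lemma frob_ge1mxl p q (S : 'M[R]_p) (N : 'M[R]_(p, q)) :
  ge1mx S -> frob N <= frob (S *m N).
Proof.
move=> [_ S1]; have := le_trans (S1 _ N) (ip_le_frob N (S *m N)).
have [->|] := eqVneq N 0; first by rewrite frob0.
by rewrite -frob_gt0 => X0; rewrite -sqr_frob expr2 ler_pM2l.
Qed.

Lemma frob_ge1mxr p q (S : 'M[R]_p) (N : 'M[R]_(q, p)) :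
  ge1mx S -> frob N <= frob (N *m S).
Proof.
move=> S1; rewrite -frob_trmx -(frob_trmx (N *m S)) trmx_mul.
by rewrite (proj1 S1) frob_ge1mxl.
Qed.

Lemma ge1mx_unit p (S : 'M[R]_p) : ge1mx S -> S \in unitmx.
Proof.
move=> S1; rewrite -row_free_unit; apply: inj_row_free => v vS.
have := frob_ge1mxr v S1; rewrite vS frob0 => v0.
by apply/frob_eq0/eqP; rewrite eq_le v0 frob_ge0.
Qed.

(** The root [Q] picked by [get] is only known to be positive semidefinite. Its difference [D] from
    the root [S] built above satisfies [Q D + D S = Q^2 - S^2 = 0]; pairing with [D] gives
    [|D|^2 <= 0]. *)
Lemma sqrtmxP p (P : 'M[R]_p) :
  ge1mx P -> ge1mx (sqrtmx P) /\ sqrtmx P *m sqrtmx P = P.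
Proof.
move=> /ge1mx_sqrt_exists[S [S1 SS]].
have : exists S, [set S | [/\ S^T = S,
    forall x : 'cV[R]_p, 0 <= (x^T *m S *m x) 0 0 & S *m S = P]] S.
  by exists S; split=> //; [exact: proj1 S1 | move=> x; exact: ge1mx_psd].
move/getPex; rewrite -/(sqrtmx P); case; set Q := sqrtmx P => Qs Q0 QQ.
suff -> : Q = S by [].
pose D := Q - S.
have : ip D (Q *m D) + ip D (D *m S) = 0.
  rewrite -ipDr /D mulmxBr mulmxBl addrA subrK QQ SS subrr ip0r//.
have h1 := ip_psd_ge0 D Q0; have h2 := ge1mx_mulr D S1.
have h3 := ip_ge0 D => h4; apply/eqP; rewrite -subr_eq0 -/D; apply/eqP/frob_eq0.
by apply/eqP; rewrite -sqrf_eq0 sqr_frob; apply/eqP; lra.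
Qed.

(** Solution operator of [S Y + Y S = E], encoded as the inverse of the vectorized left-hand side so
    that it is linear by construction. *)
Definition lyap p (S E : 'M[R]_p) : 'M[R]_p :=
  vec_mx (mxvec E *m invmx (lin_mx (mulmx S \+ mulmxr S))).

Lemma lyap_linear p (S : 'M[R]_p) : linear (lyap S).
Proof. by move=> a E F; rewrite /lyap linearP mulmxDl -scalemxAl linearP. Qed.

(** [frob_lyapunov] makes the Lyapunov operator injective, hence invertible in finite dimension. *)
Lemma lyapP p (S E : 'M[R]_p) : ge1mx S ->
  S *m lyap S E + lyap S E *m S = E.
Proof.
move=> S1; set f := mulmx S \+ mulmxr S.
have fE Y : f Y = S *m Y + Y *m S by [].
have fu : lin_mx f \in unitmx.
  rewrite -row_free_unit; apply: inj_row_free => v.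
  rewrite -(vec_mxK v) mul_vec_lin => /(canRL mxvecK); rewrite linear0 => e0.
  have e : S *m vec_mx v + vec_mx v *m S = 0 by exact: e0.
  have := frob_lyapunov (vec_mx v) S1 S1; rewrite e frob0 => v0.
  rewrite (_ : vec_mx v = 0) ?linear0//; apply: frob_eq0.
  by have := frob_ge0 (vec_mx v); lra.
rewrite -fE; apply: (can_inj mxvecK).
by rewrite -mul_vec_lin /lyap -/f vec_mxK mulmxKV.
Qed.

Definition gram m p (B : 'M[R]_(m, p)) : 'M[R]_p := 1%:M + B^T *m B.

Lemma ip_gram m p q (B : 'M[R]_(m, p)) (X : 'M[R]_(p, q)) :
  ip X (gram B *m X) = ip X X + ip (B *m X) (B *m X).
Proof. by rewrite mulmxDl mul1mx ipDr ipMl mulmxA. Qed.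

Lemma gram_ge1 m p (B : 'M[R]_(m, p)) : ge1mx (gram B).
Proof.
split=> [|q N]; first by rewrite linearD /= trmx1 trmx_mul trmxK.
by rewrite ip_gram lerDl ip_ge0.
Qed.

(** * Contraction bounds and the derivative of the square root at a given [B] *)

Section FixedPoint.
Context {m p : nat} (B : 'M[R]_(m, p)).
Let S := sqrtmx (gram B).
Let T := invmx S.
Let S1 : ge1mx S. Proof. exact: (sqrtmxP (gram_ge1 B)).1. Qed.
Let SS : S *m S = gram B. Proof. exact: (sqrtmxP (gram_ge1 B)).2. Qed.
Let Su : S \in unitmx. Proof. exact: ge1mx_unit. Qed.

(** Both sides equal [<X, S^2 X>]. With [X] replaced by [T X], this is the source of the contraction
    bounds on [B T] and on the stacked factor. *)
Lemma sqr_frob_sqrt_gram q (X : 'M[R]_(p, q)) :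
  frob X ^+ 2 + frob (B *m X) ^+ 2 = frob (S *m X) ^+ 2.
Proof.
by rewrite !sqr_frob -ip_gram -SS ipMl (proj1 S1) mulmxA.
Qed.

Lemma frob_invl q (X : 'M[R]_(p, q)) : frob (T *m X) <= frob X.
Proof. by rewrite -{2}(mulKVmx Su X) frob_ge1mxl. Qed.

Lemma frob_invr q (X : 'M[R]_(q, p)) : frob (X *m T) <= frob X.
Proof. by rewrite -{2}(mulmxKV Su X) frob_ge1mxr. Qed.

Lemma frob_orthonormal_factor q (Q : 'M[R]_p) (X : 'M[R]_(p, q)) :
  (forall N : 'M[R]_(p, q), frob (Q *m N) <= frob N) ->
  frob (col_mx Q B *m T *m X) <= frob X.
Proof.
move=> Q1; rewrite -ler_sqr ?nnegrE// -mulmxA mul_col_mx sqr_frob_col_mx.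
rewrite -[X in _ <= frob X ^+ 2](mulKVmx Su) -sqr_frob_sqrt_gram lerD2r.
by rewrite ler_sqr ?nnegrE.
Qed.

(** By duality: for [W = V B T], [|W|^2 = <V, W (B T)^T>], and the last factor has norm at most
    [|W|] because [B T] contracts from the left. *)
Lemma frob_mul_polar q (V : 'M[R]_(q, m)) : frob (V *m (B *m T)) <= frob V.
Proof.
have [e|] := eqVneq (V *m (B *m T)) 0; first by rewrite e frob0.
rewrite -frob_gt0 => W0; rewrite -(ler_pM2r W0) -expr2 sqr_frob ipMr.
apply: le_trans (ip_le_frob _ _) _; rewrite ler_wpM2l//.
rewrite -[X in X <= _]frob_trmx trmx_mul trmxK -[X in _ <= X]frob_trmx.
move: (_^T) => X; rewrite -mulmxA -ler_sqr ?nnegrE//.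
by rewrite -{2}(mulKVmx Su X) -sqr_frob_sqrt_gram lerDr exprn_ge0.
Qed.

(** The derivative of the root of [gram] at [B] in direction [K], found by differentiating
    [S^2 = gram B]. *)
Definition dsqrt (K : 'M[R]_(m, p)) : 'M[R]_p :=
  lyap S (K^T *m B + B^T *m K).

Lemma dsqrtP K : S *m dsqrt K + dsqrt K *m S = K^T *m B + B^T *m K.
Proof. exact: lyapP. Qed.

(** The transpose solves the same Lyapunov equation, whose solution is unique. *)
Lemma dsqrt_sym K : (dsqrt K)^T = dsqrt K.
Proof.
apply/eqP; rewrite -subr_eq0; apply/eqP/frob_eq0.
set Y := dsqrt K; have e := dsqrtP K; rewrite -/Y in e.
have := frob_lyapunov (Y^T - Y) S1 S1.
have -> : S *m (Y^T - Y) + (Y^T - Y) *m S = 0.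
  have et : S *m Y^T + Y^T *m S = K^T *m B + B^T *m K.
    rewrite -{1 2}(proj1 S1) -!trmx_mul -linearD /= addrC e.
    by rewrite linearD /= !trmx_mul !trmxK addrC.
  by rewrite mulmxBr mulmxBl addrACA et -opprD e subrr.
by rewrite frob0; have := frob_ge0 (Y^T - Y); lra.
Qed.

Lemma frob_dsqrt_inv K : frob (dsqrt K *m T) <= 2 * frob K.
Proof.
set Y := dsqrt K.
have Ts : T^T = T by rewrite trmx_inv (proj1 S1).
pose G := T *m K^T *m (B *m T).
have e : T *m Y + Y *m T = G + G^T.
  transitivity (T *m (K^T *m B + B^T *m K) *m T).
    rewrite -dsqrtP -/Y.
    rewrite mulmxDr mulmxDl mulmxA mulVmx// mul1mx -!mulmxA mulmxV// mulmx1.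
    by rewrite addrC.
  by rewrite mulmxDr mulmxDl /G !trmx_mul Ts trmxK !mulmxA.
have Gb : frob G <= frob K.
  apply: le_trans (frob_mul_polar _) (le_trans (frob_invl _) _).
  by rewrite frob_trmx.
have TY : frob (T *m Y) = frob (Y *m T).
  by rewrite -frob_trmx trmx_mul Ts dsqrt_sym.
(* With [J] the inverse of a root of [S], [T = J^2] and the inner product becomes [|J Y J|^2]. *)
have pos : 0 <= ip (T *m Y) (Y *m T).
  have [Q [Q1 QQ]] := ge1mx_sqrt_exists S1; have Qu := ge1mx_unit Q1.
  pose J := invmx Q; have Js : J^T = J by rewrite trmx_inv (proj1 Q1).
  have -> : T = J *m J.
    apply: (can_inj (mulKmx Su)); rewrite mulmxV// -QQ -mulmxA.
    by rewrite [Q *m (J *m J)]mulmxA mulmxV// mul1mx mulmxV.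
  suff -> : ip (J *m J *m Y) (Y *m (J *m J)) = ip (J *m Y *m J) (J *m Y *m J).
    exact: ip_ge0.
  by rewrite [RHS]ipMr Js -(mulmxA J J Y) [LHS]ipMl Js !mulmxA.
(* This amounts to [|Y T| <= sqrt 2 |K|], which is then weakened to the constant 2. *)
have : (2 * frob (Y *m T)) ^+ 2 <= 2 * (2 * frob K) ^+ 2.
  have := ip_ge0 (T *m Y + Y *m T).
  have : frob (T *m Y + Y *m T) ^+ 2 <= (2 * frob K) ^+ 2.
    rewrite ler_sqr ?nnegrE ?mulr_ge0// e; apply: le_trans (frobD _ _) _.
    by rewrite frob_trmx mulr_natl mulr2n lerD.
  rewrite sqr_frob ipDl !ipDr (ipC (Y *m T) (T *m Y)) -!sqr_frob TY; nra.
have := frob_ge0 K; have := frob_ge0 (Y *m T) => h1 h2 h3.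
rewrite -ler_sqr ?nnegrE ?mulr_ge0//; nra.
Qed.

(** The increment [D] solves [S D + D S' = E + K^T K], and its error [D - dsqrt K] solves a Lyapunov
    equation with right-hand side [K^T K - D^2]. Both bounds follow from [frob_lyapunov]. *)
Lemma sqrtmx_gram_remainder (K : 'M[R]_(m, p)) : frob K <= 1 ->
  frob (sqrtmx (gram (B + K)) - S) <= (frob B + 1) * frob K /\
  frob (sqrtmx (gram (B + K)) - S - dsqrt K) <= (frob B + 1) ^+ 2 * frob K ^+ 2.
Proof.
move=> K1; set S' := sqrtmx _.
have [S1' SS'] := sqrtmxP (gram_ge1 (B + K)); rewrite -/S' in S1' SS'.
pose E := K^T *m B + B^T *m K; set D := S' - S.
have e1 : S *m D + D *m S' = E + K^T *m K.
  rewrite /D mulmxBr mulmxBl addrC addrA subrK SS SS' /gram.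
  rewrite [(B + K)^T]linearD mulmxDl !mulmxDr /E /= opprD addrACA.
  rewrite subrr add0r -[X in X - _]addrA [X in X - _]addrC addrK.
  by rewrite addrA [B^T *m K + _]addrC.
have e2 : S *m (D - dsqrt K) + (D - dsqrt K) *m S = K^T *m K - D *m D.
  have : S *m D + D *m S = E + K^T *m K - D *m D.
    by rewrite -e1 -addrA -mulmxBr /D subKr.
  rewrite (mulmxBr S D) (mulmxBl D) addrACA -opprD dsqrtP => ->.
  by rewrite -/E addrAC (addrC E) addrK.
have b1 := frob_lyapunov D S1 S1'; rewrite e1 in b1.
have b2 := frob_lyapunov (D - dsqrt K) S1 S1; rewrite e2 in b2.
have bK : frob (K^T *m K) <= frob K ^+ 2.
  by apply: le_trans (frobM _ _) _; rewrite frob_trmx expr2.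
have bE : frob E <= 2 * (frob B * frob K).
  apply: le_trans (frobD _ _) _; rewrite mulr_natl mulr2n lerD//.
    by apply: le_trans (frobM _ _) _; rewrite frob_trmx mulrC.
  by apply: le_trans (frobM _ _) _; rewrite frob_trmx.
have b0 := frob_ge0 B; have k0 := frob_ge0 K; have d0 := frob_ge0 D.
(* Here [|K| <= 1] absorbs the quadratic term into a linear one. *)
have bD : frob D <= (frob B + 1) * frob K.
  by have := frobD E (K^T *m K); nra.
split=> //.
have : frob (D *m D) <= ((frob B + 1) * frob K) ^+ 2.
  by apply: le_trans (frobM _ _) _; rewrite expr2 ler_pM.
by have := frobB (K^T *m K) (D *m D); nra.
Qed.

End FixedPoint.
End PolarFactor.

(** * The matrix exponential *)

Section Exponential.
Context {R : realType} {p : nat}.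
Implicit Types (A B H N : 'M[R]_p) (a c h t : R).

(** The Frobenius norm of [A ^+ 0] is that of the identity, not 1, so every bound on powers carries
    this factor. *)
Let c0 : R := frob (1%:M : 'M[R]_p).
Let c0_ge0 : 0 <= c0. Proof. exact: frob_ge0. Qed.

(** Domination by a scalar exponential series serves three series: [expmx], its derivative and its
    remainder. *)
Lemma exp_dominated_cvg m n (u : nat -> 'M[R]_(m, n)) c a :
  0 <= c -> 0 <= a -> (forall k, frob (u k) <= c * exp_coeff a k) ->
  cvgn (series u) /\ frob (limn (series u)) <= c * expR a.
Proof.
move=> cge age uc.
have cE : cvgn (series (fun k => c * exp_coeff a k)).
  exact: is_cvg_seriesZ (is_cvg_series_exp_coeff a).
have cu := frob_cvg_series uc cE; split=> //.
apply: (cvgr_to_le (frob_cvg cu)); near=> k.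
apply: le_trans (frob_sum _ _ _) _.
apply: (@le_trans _ _ (c * series (exp_coeff a) k)).
  by rewrite /series /= mulr_sumr; apply: ler_sum => i _; exact: uc.
rewrite ler_wpM2l//.
apply: nondecreasing_cvgn_le; last exact: is_cvg_series_exp_coeff.
by apply: nondecreasing_series => i *; apply: exp_coeff_ge0.
Unshelve. all: by end_near. Qed.

Lemma frob_expr A a k : frob A <= a -> frob (A ^+ k) <= c0 * a ^+ k.
Proof.
move=> Aa; elim: k => [|k IH]; first by rewrite !expr0 mulr1.
rewrite !exprSr mulrA; apply: le_trans (frobM _ _) _.
by apply: ler_pM.
Qed.

Lemma cvg_expmx A : series (fun k => (k`!%:R)^-1 *: A ^+ k) @ \oo --> expmx A.
Proof.
have [] := @exp_dominated_cvg _ _ (fun k => (k`!%:R)^-1 *: A ^+ k) c0 (frob A).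
- exact: frob_ge0.
- exact: frob_ge0.
- move=> k; rewrite frobZ ger0_norm ?invr_ge0// mulrC /exp_coeff /= mulrA.
  by rewrite ler_wpM2r ?invr_ge0// frob_expr.
by [].
Qed.

Section Derivative.
Variable A : 'M[R]_p.

(** The derivative of [A ^+ k] in direction [H], that is the sum of [A^i H A^j] over
    [i + j = k - 1], unfolded by the product rule for [A ^+ k * A]. *)
Fixpoint dpow H k : 'M[R]_p :=
  if k is k'.+1 then dpow H k' * A + A ^+ k' * H else 0.

Let rho : R := frob A + 1.
Let rho_ge1 : 1 <= rho. Proof. by rewrite lerDr. Qed.
Let rho_ge0 : 0 <= rho. Proof. exact: le_trans rho_ge1. Qed.

(** There are [k] summands. As [rho >= 1], the exponent [k - 1] may be raised to [k], which avoids a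
    truncated subtraction at 0. *)
Lemma frob_dpow H k : frob (dpow H k) <= c0 * (k%:R * rho ^+ k * frob H).
Proof.
elim: k => [|k IH]; first by rewrite /= frob0 !mul0r mulr0.
have Ak : frob (A ^+ k) <= c0 * rho ^+ k.
  by apply: frob_expr; rewrite lerDl.
have rk : 0 <= rho ^+ k by rewrite exprn_ge0.
have rk1 : rho ^+ k <= rho ^+ k.+1 by rewrite exprS ler_peMl.
apply: le_trans (frobD _ _) _.
rewrite -addn1 natrD [_ + 1]addrC !mulrDl mulrDr mul1r addrC addn1.
apply: lerD.
  apply: le_trans (frobM _ _) _; rewrite mulrA ler_wpM2r//.
  by apply: le_trans Ak _; rewrite ler_wpM2l.
apply: le_trans (frobM _ _) _.
apply: le_trans (ler_wpM2r (frob_ge0 _) IH) _.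
rewrite exprSr; have : frob A <= rho by rewrite lerDl.
have : 0 <= c0 * (k%:R * rho ^+ k * frob H) by rewrite !mulr_ge0.
move: (frob H) (rho ^+ k) => h r g0 Ar.
by have := ler_wpM2l g0 Ar; nra.
Qed.

(** The remainders satisfy [R_(k+1) = R_k (A + H) + dpow H k * H], and [k^2 + k <= (k + 1)^2] closes
    the induction. *)
Lemma frob_expr_remainder H k : frob H <= 1 ->
  frob ((A + H) ^+ k - A ^+ k - dpow H k) <=
  c0 * (k%:R ^+ 2 * rho ^+ k * frob H ^+ 2).
Proof.
move=> H1; elim: k => [|k IH].
  by rewrite /= subr0 subrr frob0 expr0n /= !mul0r mulr0.
have -> : (A + H) ^+ k.+1 - A ^+ k.+1 - dpow H k.+1 =
    ((A + H) ^+ k - A ^+ k - dpow H k) * (A + H) + dpow H k * H.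
  rewrite !exprSr /= mulrBl mulrBl (mulrDr (dpow H k)) (mulrDr (A ^+ k)).
  by rewrite !opprD !addrA; rewrite addrNK addrAC.
have AH : frob (A + H) <= rho by apply: le_trans (frobD _ _) _; rewrite lerD2l.
apply: le_trans (frobD _ _) _.
have s1 := le_trans (frobM ((A + H) ^+ k - A ^+ k - dpow H k) (A + H))
  (ler_pM (frob_ge0 _) (frob_ge0 _) IH AH).
have s2 := le_trans (frobM (dpow H k) H)
  (ler_wpM2r (frob_ge0 H) (frob_dpow H k)).
apply: le_trans (lerD s1 s2) _.
have rk : 0 <= c0 * rho ^+ k * frob H ^+ 2.
  by rewrite !mulr_ge0 ?exprn_ge0.
have rk1 : c0 * rho ^+ k * frob H ^+ 2 <= c0 * rho ^+ k * frob H ^+ 2 * rho.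
  by rewrite ler_peMr.
rewrite (exprSr rho) -natr1.
move: (ler0n R k) rk rk1; set x := k%:R; set y := _ * frob H ^+ 2 => x0 y0 yr.
have -> : c0 * ((x + 1) ^+ 2 * (rho ^+ k * rho) * frob H ^+ 2) =
  (x + 1) ^+ 2 * (y * rho) by rewrite /y; ring.
have -> : c0 * (x ^+ 2 * rho ^+ k * frob H ^+ 2) * rho = x ^+ 2 * (y * rho).
  by rewrite /y; ring.
have -> : c0 * (x * rho ^+ k * frob H) * frob H = x * y by rewrite /y; ring.
have := ler_wpM2l x0 yr; have := le_trans y0 yr => z0 h.
have := mulr_ge0 x0 z0; nra.
Qed.

(** Exchanging polynomial factors for powers of 4 keeps the series dominated by an exponential one,
    at [4 * rho]. *)
Lemma sqr_le_expn4 k : (k%:R : R) ^+ 2 <= 4 ^+ k.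
Proof.
have -> : (4 : R) = 2 ^+ 2 by rewrite expr2 -natrM.
rewrite exprAC ler_pXn2r ?nnegrE ?exprn_ge0// -natrX ler_nat ltnW//.
exact: ltn_expl.
Qed.

Lemma le_expn4 k : (k%:R : R) <= 4 ^+ k.
Proof.
apply: le_trans (sqr_le_expn4 k); case: k => [|k]; first by rewrite expr0n.
by rewrite expr2 ler_peMl// ler1n.
Qed.

Let term H k := (k`!%:R)^-1 *: dpow H k.
Definition dexp H : 'M[R]_p := limn (series (term H)).

Lemma cvg_dexp H : series (term H) @ \oo --> dexp H.
Proof.
have [] := @exp_dominated_cvg _ _ (term H) (c0 * frob H) (4 * rho).
- by rewrite mulr_ge0.
- by rewrite mulr_ge0.
- move=> k; rewrite frobZ ger0_norm ?invr_ge0// mulrC /exp_coeff /= mulrA.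
  rewrite ler_wpM2r ?invr_ge0//; apply: le_trans (frob_dpow _ _) _.
  rewrite exprMn -[X in _ <= X]mulrA [frob H * _]mulrC.
  by rewrite ler_wpM2l// ler_wpM2r// ler_wpM2r ?exprn_ge0// le_expn4.
by [].
Qed.

Lemma dpow_linear k : linear (dpow ^~ k).
Proof.
move=> a H N; elim: k => [|k IH]; first by rewrite /= scaler0 addr0.
rewrite /= IH mulrDl mulrDr scalerDr.
have -> : (a *: dpow H k) * A = a *: (dpow H k * A) by rewrite [RHS]scalemxAl.
have -> : A ^+ k * (a *: H) = a *: (A ^+ k * H) by rewrite [RHS]scalemxAr.
by rewrite addrACA.
Qed.

Lemma dexp_linear : linear dexp.
Proof.
move=> a H N; apply: cvg_mx_unique (@cvg_dexp _) _.
rewrite (_ : series _ = (a \*: series (term H)) \+ series (term N)); last first.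
  apply/funext => n; rewrite /series /= scaler_sumr -big_split /=.
  apply: eq_bigr => k _; rewrite /term dpow_linear scalerDr !scalerA.
  by rewrite [_ * a]mulrC.
by apply: cvgD (@cvg_dexp N); apply: cvgZl_tmp; exact: cvg_dexp.
Qed.

(** The remainders of the powers are summed term by term with [exp_dominated_cvg]. *)
Lemma expmx_remainder H : frob H <= 1 ->
  frob (expmx (A + H) - expmx A - dexp H) <=
  c0 * expR (4 * rho) * frob H ^+ 2.
Proof.
move=> H1.
pose u k : 'M[R]_p := (k`!%:R)^-1 *: ((A + H) ^+ k - A ^+ k - dpow H k).
have [] := @exp_dominated_cvg _ _ u (c0 * frob H ^+ 2) (4 * rho).
- by rewrite mulr_ge0 ?exprn_ge0.
- by rewrite mulr_ge0.
- move=> k; rewrite frobZ ger0_norm ?invr_ge0// mulrC /exp_coeff /= mulrA.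
  rewrite ler_wpM2r ?invr_ge0//; apply: le_trans (frob_expr_remainder _ H1) _.
  rewrite exprMn -[X in _ <= X]mulrA [frob H ^+ 2 * _]mulrC.
  by rewrite ler_wpM2l// !ler_wpM2r ?exprn_ge0// sqr_le_expn4.
move=> _; rewrite mulrAC; 
suff -> : limn (series u) = expmx (A + H) - expmx A - dexp H by [].
apply: cvg_lim; first exact: norm_hausdorff.
have -> : series u = series (fun k => (k`!%:R)^-1 *: (A + H) ^+ k)
    \- series (fun k => (k`!%:R)^-1 *: A ^+ k) \- series (term H).
  apply/funext => n; rewrite /series /= -!sumrB.
  by apply: eq_bigr => k _; rewrite /u !scalerBr.
by apply: cvgB (@cvg_dexp H); apply: cvgB; exact: cvg_expmx.
Qed.

End Derivative.
End Exponential.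

HB.instance Definition _ (R : realType) p (A : 'M[R]_p) :=
  GRing.isLinear.Build R 'M[R]_p 'M[R]_p *:%R (dexp A) (@dexp_linear R p A).

(** * The exponential as the limit of Euler products *)

Section EulerApproximation.
Context {R : realType} {p : nat}.
Implicit Types (A B H : 'M[R]_p).

Lemma ffact_le_expn n k : (n ^_ k <= n ^ k)%N.
Proof.
elim: k => // k IH; rewrite ffactnSr expnSr.
by apply: leq_mul => //; exact: leq_subr.
Qed.

Lemma expR_sub_euler (a : R) n : 0 <= a ->
  expR a - (1 + a / n.+1%:R) ^+ n.+1 <= a ^+ 2 * expR a / n.+1%:R.
Proof.
move=> a0; set x := a / _; set b := expR x.
have x0 : 0 <= x by rewrite divr_ge0.
have ax : a = n.+1%:R * x by rewrite /x mulrCA divff ?mulr1.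
have b0 : 0 < b by exact: expR_gt0.
have bx : 1 + x <= b by exact: expR_ge1Dx.
(* From [exp(-x) >= 1 - x] one gets [b - 1 <= x b], hence [b - 1 - x <= x (b - 1) <= x^2 b]. *)
have bxx : b - (1 + x) <= x ^+ 2 * b.
  have : b * (1 - x) <= 1.
    rewrite -[leRHS](mulfV (lt0r_neq0 b0)) ler_pM2l// -expRN.
    exact: expR_ge1Dx.
  nra.
have e k : b ^+ k.+1 - (1 + x) ^+ k.+1 <= k.+1%:R * (x ^+ 2 * b ^+ k.+1).
  elim: k => [|k IH]; first by rewrite !expr1 mul1r.
  have -> : b ^+ k.+2 - (1 + x) ^+ k.+2 =
      b * (b ^+ k.+1 - (1 + x) ^+ k.+1) + (b - (1 + x)) * (1 + x) ^+ k.+1.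
    by rewrite !(exprS _ k.+1); ring.
  rewrite -(@natr1 _ k.+1) [X in _ <= X]mulrDl mul1r lerD//.
    by rewrite (exprS b k.+1) [x ^+ 2 * _]mulrCA [X in _ <= X]mulrCA ler_pM2l.
  rewrite (exprS b k.+1) mulrA ler_pM// ?exprn_ge0 ?subr_ge0 ?addr_ge0//.
  by rewrite lerXn2r ?nnegrE ?addr_ge0// ltW.
have -> : expR a = b ^+ n.+1 by rewrite ax expRM_natl.
apply: le_trans (e n) _.
have -> : n.+1%:R * (x ^+ 2 * b ^+ n.+1) = a ^+ 2 * b ^+ n.+1 / n.+1%:R.
  by rewrite ax; field; rewrite nat1r pnatr_eq0.
by [].
Qed.

(** The shift to [n.+1] keeps the denominator nonzero for every [n]. *)
Definition euler A n : 'M[R]_p := (1%:M + n.+1%:R^-1 *: A) ^+ n.+1.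

Lemma eulerE A n : euler A n =
  \sum_(k < n.+2) (('C(n.+1, k))%:R / n.+1%:R ^+ k) *: A ^+ k.
Proof.
rewrite /euler addrC exprD1n; apply: eq_bigr => k _.
have -> : (n.+1%:R^-1 *: A) ^+ k = (n.+1%:R^-1 ^+ k) *: A ^+ k.
  elim: (k : nat) => [|j IH]; first by rewrite !expr0 scale1r.
  rewrite !exprS IH.
  have -> : (n.+1%:R^-1 *: A) * (n.+1%:R^-1 ^+ j *: A ^+ j) =
      n.+1%:R^-1 *: (A *m (n.+1%:R^-1 ^+ j *: A ^+ j)) by rewrite [RHS]scalemxAl.
  by rewrite -scalemxAr scalerA.
by rewrite -scaler_nat scalerA exprVn.
Qed.

(** The coefficients of the Taylor polynomial dominate those of the Euler product. The matrix error
    is therefore at most the scalar error at [frob A], times the norm of the identity, and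
    [expR_sub_euler] applies. *)
Lemma cvg_euler A : euler A @ \oo --> expmx A.
Proof.
pose a := frob A; have a0 : 0 <= a by exact: frob_ge0.
(* With [n.+2] terms the partial sum has degree [n.+1], like the Euler product. *)
pose S n := series (fun k => (k`!%:R)^-1 *: A ^+ k) n.+2.
have cS : S @ \oo --> expmx A.
  have := @cvg_expmx _ _ A; rewrite -cvg_shiftS => cu.
  by rewrite -cvg_shiftS in cu.
pose c n k : R := (k`!%:R)^-1 - 'C(n.+1, k)%:R / n.+1%:R ^+ k.
have c_ge0 n k : 0 <= c n k.
  rewrite subr_ge0 ler_pdivrMr ?exprn_gt0// mulrC ler_pdivlMr ?ltr0n ?fact_gt0//.
  by rewrite -natrM bin_ffact -natrX ler_nat ffact_le_expn.
have dS : S n - euler A n @[n --> \oo] --> (0 : 'M[R]_p).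
  apply/cvg_frobP.
  pose M := frob (1%:M : 'M[R]_p) * (a ^+ 2 * expR a).
  apply: (@squeeze_cvgr _ _ _ _ (cst 0) (fun n => M * harmonic n)); last 2 first.
  - exact: cvg_cst.
  - by rewrite -[X in _ --> X](mulr0 M); apply: cvgMl_tmp; exact: cvg_harmonic.
  near=> n; rewrite frob_ge0 subr0 /=.
  have -> : S n - euler A n = \sum_(k < n.+2) c n k *: A ^+ k.
    rewrite eulerE /S /series /= big_mkord -sumrB.
    by apply: eq_bigr => k _; rewrite scalerBl.
  apply: le_trans (frob_sum _ _ _) _.
  apply: (@le_trans _ _ (frob (1%:M : 'M[R]_p) * \sum_(k < n.+2) c n k * a ^+ k)).
    rewrite mulr_sumr; apply: ler_sum => k _.
    by rewrite frobZ ger0_norm// mulrCA ler_wpM2l// frob_expr.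
  rewrite /M /harmonic /= -mulrA ler_wpM2l//.
  apply: le_trans (expR_sub_euler n a0).
  have -> : \sum_(k < n.+2) c n k * a ^+ k =
      series (exp_coeff a) n.+2 - (1 + a / n.+1%:R) ^+ n.+1.
    rewrite /series /= big_mkord [1 + _]addrC exprD1n -sumrB.
    apply: eq_bigr => k _.
    rewrite /c mulrBl /exp_coeff /= exprMn exprVn mulrC -mulr_natl.
    by congr (_ - _); ring.
  rewrite lerD2r.
  apply: nondecreasing_cvgn_le; last exact: is_cvg_series_exp_coeff.
  by apply: nondecreasing_series => k *; apply: exp_coeff_ge0.
have : S n - (S n - euler A n) @[n --> \oo] --> expmx A - 0 by exact: cvgB.
rewrite subr0 (_ : (fun n => _) = euler A)//.
by apply/funext => n; rewrite subKr.
Unshelve. all: by end_near. Qed.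

End EulerApproximation.

(** * Contraction and Lipschitz bounds for the exponential of skew matrices *)

Section SkewExponential.
Context {R : realType} {p : nat}.
Implicit Types (A B H X Y : 'M[R]_p).

(** Skewness makes [N] and [A N] orthogonal, so the factor deviates from 1 only to second order in
    [s]. Its exponential form makes the power in [rateE] explicit. *)
Lemma frob_one_plus_skew q A (N : 'M[R]_(p, q)) (s : R) : A^T = - A ->
  frob ((1%:M + s *: A) *m N) <= expR (s ^+ 2 * frob A ^+ 2) * frob N.
Proof.
move=> As; rewrite frob_le ?expR_ge0//.
have AN : ip N (A *m N) = 0.
  suff : ip N (A *m N) = - ip N (A *m N) by lra.
  by rewrite {1}ipC ipMl As mulNmx ipNr.
rewrite mulmxDl mul1mx -scalemxAl !(ipDl, ipDr, ipZl, ipZr) (ipC _ N) AN.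
have h := expR_ge1Dx (s ^+ 2 * frob A ^+ 2).
have w0 : 0 <= s ^+ 2 * frob A ^+ 2 by rewrite mulr_ge0 ?sqr_ge0.
have AN2 : ip (A *m N) (A *m N) <= frob A ^+ 2 * ip N N.
  by rewrite -!sqr_frob -exprMn ler_sqr ?nnegrE ?mulr_ge0// frobM.
have n0 := ip_ge0 N; have s0 := sqr_ge0 s.
apply: (@le_trans _ _ ((1 + s ^+ 2 * frob A ^+ 2) * ip N N)).
  by have := ler_wpM2l s0 AN2; rewrite expr2; lra.
rewrite ler_wpM2r// (le_trans h)// expr2 ler_peMl ?expR_ge0//.
by apply: le_trans h; rewrite lerDl.
Qed.

Lemma frob_expr_mul q X (N : 'M[R]_(p, q)) (c : R) k : 0 <= c ->
  (forall N : 'M[R]_(p, q), frob (X *m N) <= c * frob N) ->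
  frob (X ^+ k *m N) <= c ^+ k * frob N.
Proof.
move=> c0 Xc; elim: k => [|k IH]; first by rewrite !expr0 mul1mx mul1r.
rewrite exprS -[X * _]/(X *m _) -mulmxA exprS -mulrA.
by apply: le_trans (Xc _) _; rewrite ler_wpM2l.
Qed.

(** Telescoping with powers of [X] on the left and of [Y] on the right uses only the operator bounds
    [c], never the larger Frobenius norms of the powers. *)
Lemma frob_expr_sub X Y (c : R) k : 1 <= c ->
  (forall N : 'M[R]_p, frob (X *m N) <= c * frob N) ->
  (forall N : 'M[R]_p, frob (N *m Y) <= c * frob N) ->
  frob (X ^+ k - Y ^+ k) <= k%:R * c ^+ k * frob (X - Y).
Proof.
move=> c1 Xc Yc; have c0 : 0 <= c by exact: le_trans c1.
have Yk k' (N : 'M[R]_p) : frob (N *m Y ^+ k') <= c ^+ k' * frob N.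
  elim: k' N => [|j IH] N; first by rewrite !expr0 mulmx1 mul1r.
  rewrite exprS -[Y * _]/(Y *m _) mulmxA exprSr -mulrA.
  by apply: le_trans (IH _) _; rewrite ler_wpM2l ?exprn_ge0.
elim: k => [|k IH]; first by rewrite !expr0 subrr frob0 !mul0r.
have -> : X ^+ k.+1 - Y ^+ k.+1 = X *m (X ^+ k - Y ^+ k) + (X - Y) *m Y ^+ k.
  rewrite mulmxBr mulmxBl addrA subrK !exprS. by [].
apply: le_trans (frobD _ _) _.
rewrite -natr1 !mulrDl mul1r exprS; apply: lerD.
  apply: le_trans (Xc _) _.
  by rewrite mulrCA -mulrA ler_wpM2l// mulrA.
by apply: le_trans (Yk _ _) _; rewrite ler_wpM2r// ler_peMl ?exprn_ge0.
Qed.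

Let rate (a : R) n : R := expR (a / n.+1%:R).

Lemma rateE (a : R) n : expR (n.+1%:R^-1 ^+ 2 * a) ^+ n.+1 = rate a n.
Proof.
by rewrite -expRM_natl /rate expr2 -mulrA mulVKf ?pnatr_eq0// mulrC.
Qed.

Lemma cvg_rate (a : R) : rate a @ \oo --> (1 : R).
Proof.
have h : a / n.+1%:R @[n --> \oo] --> (0 : R).
  by rewrite -[X in _ --> X](mulr0 a); apply: cvgMl_tmp; exact: cvg_harmonic.
by rewrite -expR0; apply: cvg_comp h _; exact: continuous_expR.
Qed.

Lemma frob_expmx_skewM q A (N : 'M[R]_(p, q)) : A^T = - A ->
  frob (expmx A *m N) <= frob N.
Proof.
move=> As.
have cE : frob (euler A n *m N) @[n --> \oo] --> frob (expmx A *m N).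
  by apply/frob_cvg/(cvg_mulmx (@cvg_euler _ _ A)); exact: cvg_cst.
have cr : rate (frob A ^+ 2) n * frob N @[n --> \oo] --> frob N.
  rewrite -[X in _ --> X]mul1r; apply: cvgMr_tmp; exact: cvg_rate.
apply: ler_cvg_to cE cr _; near=> n.
rewrite -rateE; apply: frob_expr_mul; first exact: expR_ge0.
by move=> M; exact: frob_one_plus_skew.
Unshelve. all: by end_near. Qed.

(** For Euler products, the number [n.+1] of telescoping terms cancels the step [1 / n.+1]; the
    remaining factor [rate] tends to 1. *)
Lemma frob_expmx_skewB A B : A^T = - A -> B^T = - B ->
  frob (expmx A - expmx B) <= frob (A - B).
Proof.
move=> As Bs; pose a := Num.max (frob A ^+ 2) (frob B ^+ 2).
have cE : frob (euler A n - euler B n) @[n --> \oo] -->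
    frob (expmx A - expmx B).
  exact: frob_cvg (cvgB (@cvg_euler _ _ A) (@cvg_euler _ _ B)).
have cr : rate a n * frob (A - B) @[n --> \oo] --> frob (A - B).
  rewrite -[X in _ --> X]mul1r; apply: cvgMr_tmp; exact: cvg_rate.
apply: ler_cvg_to cE cr _; near=> n.
pose c := expR (n.+1%:R^-1 ^+ 2 * a).
have c1 : 1 <= c.
  by rewrite -expR0 ler_expR mulr_ge0 ?exprn_ge0 ?invr_ge0// le_max exprn_ge0.
have Ac (D : 'M[R]_p) : D^T = - D -> frob D ^+ 2 <= a ->
    forall N : 'M[R]_p, frob ((1%:M + n.+1%:R^-1 *: D) *m N) <= c * frob N.
  move=> Ds Da N; apply: le_trans (frob_one_plus_skew _ _ Ds) _.
  by rewrite ler_wpM2r// ler_expR ler_wpM2l ?exprn_ge0 ?invr_ge0.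
rewrite /euler -rateE -/c.
have := @frob_expr_sub (1%:M + n.+1%:R^-1 *: A) (1%:M + n.+1%:R^-1 *: B) c n.+1 c1.
rewrite opprD addrACA subrr add0r -scalerBr frobZ ger0_norm ?invr_ge0//.
rewrite -mulrA mulrCA (mulrA n.+1%:R) divff// mul1r; apply.
  by apply: Ac => //; rewrite le_max lexx.
(* Transposition turns right multiplication by the factor of [B] into left multiplication by that of
   [- B]. *)
move=> N; rewrite -frob_trmx trmx_mul -(frob_trmx N).
rewrite linearD linearZ /= trmx1 Bs; apply: Ac; first by rewrite linearN /= Bs.
by rewrite frobN le_max lexx orbT.
Unshelve. all: by end_near. Qed.

(** Since [A + t H] is still skew, the Lipschitz bound and the remainder give
    [t |dexp A H| <= t |H| + C t^2 |H|^2]; divide by a small [t]. *)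
Lemma frob_dexp_skew A H : A^T = - A -> H^T = - H ->
  frob (dexp A H) <= frob H.
Proof.
move=> As Hs; apply/ler_addgt0Pr => e e0.
pose C := frob (1%:M : 'M[R]_p) * expR (4 * (frob A + 1)).
have C0 : 0 <= C by rewrite mulr_ge0 ?expR_ge0.
pose h := frob H; have h0 : 0 <= h by exact: frob_ge0.
(* The first term of the denominator ensures [t h <= 1], the second [t C h^2 <= e], and the third
   positivity. *)
pose t := e / (e * h + C * h ^+ 2 + 1).
have d0 : 0 < e * h + C * h ^+ 2 + 1.
  by rewrite ltr_wpDl// addr_ge0// mulr_ge0 ?exprn_ge0// ltW.
have t0 : 0 < t by rewrite divr_gt0.
have th : t * h <= 1.
  rewrite /t mulrAC ler_pdivrMr// mul1r -addrA lerDl addr_ge0//.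
  by rewrite mulr_ge0 ?exprn_ge0.
have tC : t * (C * h ^+ 2) <= e.
  rewrite /t mulrAC ler_pdivrMr// ler_pM2l// -addrA addrCA lerDl.
  by rewrite addr_ge0// mulr_ge0// ltW.
have tH : frob (t *: H) = t * h by rewrite frobZ gtr0_norm.
have := @expmx_remainder _ _ A (t *: H); rewrite -/C tH => /(_ th) r1.
have ts : (A + t *: H)^T = - (A + t *: H).
  by rewrite linearD linearZ /= As Hs scalerN opprD.
have := frob_expmx_skewB ts As; rewrite addrAC subrr add0r tH => r2.
have dt : dexp A (t *: H) = t *: dexp A H by exact: linearZ.
rewrite -(ler_pM2l t0).
have -> : t * frob (dexp A H) = frob (dexp A (t *: H)).
  by rewrite dt frobZ gtr0_norm.
have r3 : frob (dexp A (t *: H)) <=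
    frob (expmx (A + t *: H) - expmx A) + C * (t * h) ^+ 2.
  rewrite -[dexp A _](subKr (expmx (A + t *: H) - expmx A)).
  by apply: le_trans (frobB _ _) _; rewrite lerD.
apply: le_trans r3 _; rewrite -/h mulrDr lerD// exprMn.
by rewrite mulrCA expr2 -mulrA ler_pM2l.
Qed.

End SkewExponential.

(** * The differential of phiE *)

Lemma near0_norm_le (R : realType) (V : normedModType R) (e : R) : 0 < e ->
  \forall h \near (0 : V), `|h| <= e.
Proof.
move=> e0; apply/nbhs_normP; exists e => //= h; rewrite /= sub0r normrN.
exact: ltW.
Qed.

Lemma quadratic_remainder_diff (R : realType) (V W : normedModType R)
    (f : V -> W) (x : V) (L : {linear V -> W}) (c d C : R) : 0 < d ->
  (forall h, `|L h| <= c * `|h|) ->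
  (forall h, `|h| <= d -> `|f (h + x) - f x - L h| <= C * `|h| ^+ 2) ->
  differentiable f x /\ 'd f x = L :> (V -> W).
Proof.
move=> d0 Lc fC.
have cL : continuous L.
  apply/linear_bounded_continuous; exists (Num.max c 0).
  split; first exact: num_real.
  move=> r; rewrite gt_max => /andP[cr r0].
  apply: filterS (near0_norm_le _ ltr01) => h h1; apply: le_trans (Lc h) _.
  apply: (@le_trans _ _ (r * `|h|)).
    by rewrite ler_wpM2r// ltW.
  by rewrite -[leRHS]mulr1 ler_wpM2l ?(ltW r0).
have fo : f \o shift x = cst (f x) + L +o_ (0 : V) id.
  (* [C] may have any sign; [|C| + 1] is a positive substitute by which to divide. *)
  apply/eqaddoP => e e0; have C0 : 0 < `|C| + 1 by rewrite ltr_wpDl.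
  have m0 : 0 < Num.min d (e / (`|C| + 1)) by rewrite lt_min d0 divr_gt0.
  apply: filterS (near0_norm_le _ m0) => h.
  have -> : (f \o shift x - (cst (f x) + (L : V -> W))) h = f (h + x) - f x - L h.
    by rewrite -addrA -opprD.
  rewrite le_min => /andP[hd he].
  apply: le_trans (fC h hd) _; rewrite expr2 mulrA ler_wpM2r//.
  move: he; rewrite ler_pdivlMr// => /(le_trans _); apply.
  rewrite mulrC ler_wpM2l//; have := ler_norm C; lra.
have dfE := diff_unique cL fo; split=> //.
by apply/diff_locallyP; rewrite dfE.
Qed.

Section DifferentialOfPhiE.
Context {R : realType} {p m : nat}.
Local Notation V := (skew_matrix R p * 'M[R]_(m, p))%type.
Implicit Types (X M : V).

Lemma skew_trmx (A : skew_matrix R p) : (skew_val A)^T = - skew_val A.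
Proof. by have := skew_valP A; rewrite inE => /eqP. Qed.

Definition dphiE X M : 'M[R]_(p + m, p) :=
  (col_mx (dexp (skew_val X.1) (skew_val M.1)) M.2 - phiE X *m dsqrt X.2 M.2)
    *m invmx (sqrtmx (gram X.2)).

Lemma dphiE_linear X : linear (dphiE X).
Proof.
move=> a M N; rewrite /dphiE scalemxAl -mulmxDl; congr (_ *m _).
have -> : skew_val (a *: M + N).1 = a *: skew_val M.1 + skew_val N.1 by [].
have -> : dsqrt X.2 (a *: M + N).2 = a *: dsqrt X.2 M.2 + dsqrt X.2 N.2.
  rewrite /dsqrt -lyap_linear; congr lyap.
  rewrite /= linearP /= mulmxDl mulmxDr -scalemxAl -scalemxAr scalerDr.
  by rewrite addrACA.
rewrite linearP /= mulmxDr -scalemxAr -add_col_mx -scale_col_mx.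
by rewrite scalerBr opprD addrACA.
Qed.

HB.instance Definition _ X :=
  GRing.isLinear.Build R V 'M[R]_(p + m, p) *:%R (dphiE X) (@dphiE_linear X).

Lemma sqr_frob_stack M :
  frob (stack M) ^+ 2 = frob (skew_val M.1) ^+ 2 + frob M.2 ^+ 2.
Proof. exact: sqr_frob_col_mx. Qed.

Lemma frob_le_stack1 M : frob (skew_val M.1) <= frob (stack M).
Proof. by rewrite -ler_sqr ?nnegrE// sqr_frob_stack lerDl exprn_ge0. Qed.

Lemma frob_le_stack2 M : frob M.2 <= frob (stack M).
Proof. by rewrite -ler_sqr ?nnegrE// sqr_frob_stack lerDr exprn_ge0. Qed.

Lemma frob_phiE_mul q X (N : 'M[R]_(p, q)) : frob (phiE X *m N) <= frob N.
Proof.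
apply: frob_orthonormal_factor => M; apply: frob_expmx_skewM.
exact: skew_trmx.
Qed.

Lemma frob_dphiE X M : frob (dphiE X M) <= 3 * frob (stack M).
Proof.
rewrite /dphiE mulmxBl; apply: le_trans (frobB _ _) _.
(* One copy pays for [dZ T], two for [U Y T]. *)
have -> : 3 * frob (stack M) = frob (stack M) + 2 * frob (stack M) by ring.
apply: lerD.
  apply: le_trans (frob_invr _ _) _.
  rewrite -ler_sqr ?nnegrE// sqr_frob_stack sqr_frob_col_mx lerD2r.
  rewrite ler_sqr ?nnegrE//.
  by apply: frob_dexp_skew; exact: skew_trmx.
rewrite -mulmxA; apply: le_trans (frob_phiE_mul _ _) _.
apply: le_trans (frob_dsqrt_inv _ _) _.
by rewrite ler_pM2l// frob_le_stack2.
Qed.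

(** After multiplication by the root [S'] at the displaced point, the remainder becomes [[E; 0] - U
    (S' - S - Y) - L (S' - S)]. The constant has one summand for each of these terms. *)
Lemma phiE_remainder X : exists C : R, forall M, frob (stack M) <= 1 ->
  frob (phiE (M + X) - phiE X - dphiE X M) <= C * frob (stack M) ^+ 2.
Proof.
case: X => A B; pose b := frob B + 1.
pose C1 := frob (1%:M : 'M[R]_p) * expR (4 * (frob (skew_val A) + 1)).
exists (C1 + b ^+ 2 + 3 * b) => -[H K]; set M := (H, K); set X := (A, B) => M1.
have [S1 SS] := sqrtmxP (gram_ge1 B); set S := sqrtmx _ in S1 SS.
have [S1' SS'] := sqrtmxP (gram_ge1 (B + K)); set S' := sqrtmx _ in S1' SS'.
have h1 := frob_le_stack1 M; have k1 := frob_le_stack2 M; rewrite /= in h1 k1.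
have [r2 r3] := sqrtmx_gram_remainder B (le_trans k1 M1).
rewrite -/S -/S' -/b in r2 r3.
have r1 := @expmx_remainder _ _ (skew_val A) _ (le_trans h1 M1).
rewrite -/C1 in r1.
set E := expmx _ - _ - _ in r1; set Y := dsqrt B K in r3.
set U := phiE X; set L := dphiE X M.
have US : U *m S = col_mx (expmx (skew_val A)) B.
  by rewrite /U /phiE mulmxKV//; exact: ge1mx_unit.
have US' : phiE (M + X) *m S' = col_mx (expmx (skew_val A + skew_val H)) (B + K).
  have -> : M + X = (A + H, B + K) by rewrite addrC.
  by rewrite /phiE mulmxKV//; exact: ge1mx_unit.
have LS : L *m S = col_mx (dexp (skew_val A) (skew_val H)) K - U *m Y.
  by rewrite /L /dphiE mulmxKV//; exact: ge1mx_unit.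
(* Since [S' >= 1], multiplying by it can only increase the norm, and it clears the inverse in the
   displaced [phiE]. *)
apply: le_trans (frob_ge1mxr _ S1') _.
have -> : (phiE (M + X) - U - L) *m S' =
    col_mx E 0 - U *m (S' - S - Y) - L *m (S' - S).
  rewrite !mulmxBr !mulmxBl US US' LS.
  have -> : col_mx E (0 : 'M[R]_(m, p)) =
      col_mx (expmx (skew_val A + skew_val H)) (B + K)
      - col_mx (expmx (skew_val A)) B - col_mx (dexp (skew_val A) (skew_val H)) K.
    rewrite !opp_col_mx !add_col_mx /E; congr col_mx.
    by rewrite [B + K]addrC addrK subrr.
  move: (U *m S') (L *m S') (U *m Y) (col_mx _ _) (col_mx _ _) (col_mx _ _).
  move=> a c d x y z; apply/matrixP => i j; rewrite !mxE; ring.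
have e1 : frob (col_mx E (0 : 'M[R]_(m, p))) <= C1 * frob (stack M) ^+ 2.
  have -> : frob (col_mx E (0 : 'M[R]_(m, p))) = frob E.
    apply/eqP; rewrite -(eqrXn2 (n := 2))// sqr_frob_col_mx frob0.
    by rewrite [0 ^+ 2]expr0n addr0.
  apply: le_trans r1 _; rewrite ler_wpM2l ?mulr_ge0 ?expR_ge0//.
  by rewrite ler_sqr ?nnegrE.
have b0 : 0 <= b by rewrite addr_ge0.
have e2 : frob (U *m (S' - S - Y)) <= b ^+ 2 * frob (stack M) ^+ 2.
  apply: le_trans (frob_phiE_mul _ _) (le_trans r3 _).
  by rewrite ler_wpM2l ?exprn_ge0// ler_sqr ?nnegrE.
have e3 : frob (L *m (S' - S)) <= 3 * b * frob (stack M) ^+ 2.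
  apply: le_trans (frobM _ _) _.
  rewrite expr2 mulrACA; apply: ler_pM => //; first exact: frob_dphiE.
  by apply: le_trans r2 _; rewrite ler_wpM2l.
apply: le_trans (frobB _ _) _; rewrite 2!mulrDl lerD//.
by apply: le_trans (frobB _ _) _; rewrite lerD.
Qed.

(** Links Frobenius estimates to the norm of the product space, the maximum of the component norms,
    in which the differential is defined. *)
Lemma frob_stack_le_norm M :
  frob (stack M) <= ((p * p)%:R + (m * p)%:R) * `|M|.
Proof.
apply: (@le_trans _ _ (frob (skew_val M.1) + frob M.2)).
  rewrite -ler_sqr ?nnegrE ?addr_ge0// sqr_frob_stack sqrrD.
  by rewrite -addrA lerD2l lerDr mulrn_wge0// mulr_ge0.
have -> : `|M| = Num.max `|skew_val M.1| `|M.2| by [].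
rewrite mulrDl lerD//; apply: le_trans (frob_le_normr _) _;
  by rewrite ler_wpM2l// le_max lexx ?orbT.
Qed.

Lemma diff_phiE X :
  differentiable (@phiE R p m) X /\
  'd (@phiE R p m) X = dphiE X :> (V -> 'M[R]_(p + m, p)).
Proof.
have [C XC] := phiE_remainder X.
pose k : R := (p * p)%:R + (m * p)%:R.
have k0 : 0 <= k by rewrite addr_ge0.
(* The radius [(k + 1)^-1] gives [frob (stack M) <= k / (k + 1) <= 1], as the remainder bound
   requires. *)
apply: (@quadratic_remainder_diff R _ _ _ X (dphiE X) (3 * k) (k + 1)^-1
  (`|C| * k ^+ 2)).
- by rewrite invr_gt0 ltr_wpDl.
- move=> M; apply: le_trans (normr_le_frob _) (le_trans (frob_dphiE _ _) _).
  by rewrite -mulrA ler_pM2l// frob_stack_le_norm.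
move=> M Md; apply: le_trans (normr_le_frob _) _.
have Mk := frob_stack_le_norm M; rewrite -/k in Mk.
have M1 : frob (stack M) <= 1.
  apply: le_trans Mk _; apply: le_trans (ler_wpM2l k0 Md) _.
  by rewrite ler_pdivrMr ?ltr_wpDl// mul1r lerDl.
apply: le_trans (XC M M1) _; rewrite -mulrA -exprMn.
apply: (@le_trans _ _ (`|C| * frob (stack M) ^+ 2)).
  by rewrite ler_wpM2r ?exprn_ge0// ler_norm.
by rewrite ler_wpM2l// ler_sqr ?nnegrE ?mulr_ge0.
Qed.

End DifferentialOfPhiE.

Unset Implicit Arguments.
Set Strict Implicit.

Theorem lemma3p5 (R : realType) (n p : nat) (hp : (0 < p)%N) (hpn : (p <= n)%N)
    (X : (skew_matrix R p * 'M[R]_(n - p, p))%type) :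
  differentiable (@phiE R p (n - p)) X /\
  (opnormF ('d (@phiE R p (n - p)) X) <= 3%:E)%E.
Proof.
have [dX dE] := diff_phiE X; split=> //.
(* The adjoined 0 is treated first, then the quotients, whose denominators are positive because
   [stack] is injective. *)
apply: ub_ereal_sup => _ [->|[M /= M0 <-]]; first by rewrite lee_fin.
have sM : 0 < frob (stack M).
  rewrite frob_gt0; apply: contra_neq M0 => /eqP.
  rewrite /stack col_mx_eq0 => /andP[/eqP M1 /eqP M2].
  by case: M M1 M2 => H K /= H0 ->; congr pair; apply: val_inj.
by rewrite lee_fin dE ler_pdivrMr// frob_dphiE.
Qed.
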